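(* Let $\mathcal{M}^I_m$ be a first kind meridian surface of hyperbolic type in $\mathbb{R}^4_1$, i.e. the surface parametrized by $z(u,v)=f(u)\,l(v)+g(u)\,e_1$, $u\in I$, $v\in J$, where $f,g$ are smooth on $I$ with $f>0$, $\dot f^2+\dot g^2\neq 0$, and $l=l(v)$ is a smooth timelike curve on $\mathbb{S}^2_1(1)$ with $\langle l',l'\rangle=-1$. Then $\mathcal{M}^I_m$ is a surface with flat normal connection.
   Context: $\mathbb{R}^4_1$ is the Minkowski 4-space with metric $\langle\cdot,\cdot\rangle = dx_1^2+dx_2^2+dx_3^2-dx_4^2$, and $e_1,e_2,e_3,e_4$ is its standard orthonormal frame ($\langle e_1,e_1\rangle=\langle e_2,e_2\rangle=\langle e_3,e_3\rangle=1$, $\langle e_4,e_4\rangle=-1$). $\mathbb{S}^2_1(1)=\{V\in\mathrm{span}\{e_2,e_3,e_4\}:\langle V,V\rangle=1\}$. $I,J\subset\mathbb{R}$ are intervals; a dot denotes $d/du$, a prime denotes $d/dv$. The surface is timelike, i.e. its induced metric is Lorentzian, and its normal bundle is positive definite. The normal connection $D$ is defined by the Weingarten formula $\widetilde\nabla_x\xi=-A_\xi x+D_x\xi$ ($\widetilde\nabla$ the flat connection of $\mathbb{R}^4_1$, $x$ tangent, $\xi$ normal, $A_\xi x$ tangent, $D_x\xi$ normal). Flat normal connection means that the curvature of the normal connection $K^\perp=\dfrac{\langle R^D(X,Y)N_1,N_2\rangle}{\langle X,X\rangle\langle Y,Y\rangle-\langle X,Y\rangle^2}$ vanishes identically, where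 $R^D(X,Y)N=D_XD_YN-D_YD_XN-D_{[X,Y]}N$, $\{X,Y\}$ is an orthonormal tangent frame and $\{N_1,N_2\}$ an orthonormal normal frame. *)

(* Defs.v *)
From Stdlib Require Import Reals Lra.
From Coquelicot Require Import Coquelicot.
Open Scope R_scope.

Definition R4 : Type := (R * R * R * R)%type.

Definition x1 (w : R4) : R := fst (fst (fst w)).
Definition x2 (w : R4) : R := snd (fst (fst w)).
Definition x3 (w : R4) : R := snd (fst w).
Definition x4 (w : R4) : R := snd w.

Definition e1 : R4 := (1, 0, 0, 0).
Definition e2 : R4 := (0, 1, 0, 0).
Definition e3 : R4 := (0, 0, 1, 0).
Definition e4 : R4 := (0, 0, 0, 1).

Definition mink (a b : R4) : R :=
  x1 a * x1 b + x2 a * x2 b + x3 a * x3 b - x4 a * x4 b.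

Definition deSitter2 (V : R4) : Prop :=
  (exists a b c : R, V = plus (plus (scal a e2) (scal b e3)) (scal c e4))
  /\ mink V V = 1.

(** Open, closed, half-open, bounded or not; with more than one point. *)
Definition interval (I : R -> Prop) : Prop :=
  (forall x y t, I x -> I y -> x <= t <= y -> I t)
  /\ (exists x y, I x /\ I y /\ x < y).

(** Functions are total; only their values near [I] matter.  For open [I]
    this is the usual notion (take [O := I]); an endpoint of [I] belonging to
    [I] is handled by requiring smoothness on a neighbourhood of it. *)
Definition smooth_on (I : R -> Prop) (f : R -> R) : Prop :=
  exists O : R -> Prop, open O /\ (forall t, I t -> O t) /\
    forall t, O t -> forall n, ex_derive_n f n t.

Definition smooth_curve_on (I : R -> Prop) (w : R -> R4) : Prop :=
  smooth_on I (fun t => x1 (w t)) /\ smooth_on I (fun t => x2 (w t)) /\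
  smooth_on I (fun t => x3 (w t)) /\ smooth_on I (fun t => x4 (w t)).

(** To be used with [U] open. *)
Definition smooth2_on (U : R * R -> Prop) (a : R -> R -> R) : Prop :=
  forall u v, U (u, v) -> forall n, ex_diff_n a n u v.

Definition smooth2_vec_on (U : R * R -> Prop) (w : R -> R -> R4) : Prop :=
  smooth2_on U (fun u v => x1 (w u v)) /\ smooth2_on U (fun u v => x2 (w u v)) /\
  smooth2_on U (fun u v => x3 (w u v)) /\ smooth2_on U (fun u v => x4 (w u v)).

Definition vderive (w : R -> R4) (t : R) : R4 :=
  (Derive (fun s => x1 (w s)) t, Derive (fun s => x2 (w s)) t,
   Derive (fun s => x3 (w s)) t, Derive (fun s => x4 (w s)) t).

Definition du (w : R -> R -> R4) (u v : R) : R4 := vderive (fun s => w s v) u.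
Definition dv (w : R -> R -> R4) (u v : R) : R4 := vderive (fun s => w u s) v.

(** Tangent vector fields of the surface [z] are given by their components
    [(a, b)] in the coordinate frame: the field is [a z_u + b z_v], see
    [push]. *)
Record tfield := TField { cu : R -> R -> R; cv : R -> R -> R }.

Definition push (z : R -> R -> R4) (X : tfield) (u v : R) : R4 :=
  plus (scal (cu X u v) (du z u v)) (scal (cv X u v) (dv z u v)).

Definition dir_deriv (X : tfield) (a : R -> R -> R) (u v : R) : R :=
  cu X u v * Derive (fun s => a s v) u + cv X u v * Derive (fun s => a u s) v.

Definition bracket (X Y : tfield) : tfield :=
  TField (fun u v => dir_deriv X (cu Y) u v - dir_deriv Y (cu X) u v)
         (fun u v => dir_deriv X (cv Y) u v - dir_deriv Y (cv X) u v).

(** The flat connection of the ambient space, along the surface. *)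
Definition flat_conn (X : tfield) (w : R -> R -> R4) (u v : R) : R4 :=
  plus (scal (cu X u v) (du w u v)) (scal (cv X u v) (dv w u v)).

Definition gram (z : R -> R -> R4) (u v : R) : R :=
  mink (du z u v) (du z u v) * mink (dv z u v) (dv z u v)
  - mink (du z u v) (dv z u v) ^ 2.

(** Orthogonal projections to the tangent plane [span (z_u, z_v)] and to its
    orthogonal complement; meaningful where [gram z u v <> 0]. *)
Definition tangent_part (z : R -> R -> R4) (u v : R) (w : R4) : R4 :=
  let zu := du z u v in
  let zv := dv z u v in
  plus
    (scal ((mink zv zv * mink w zu - mink zu zv * mink w zv) / gram z u v) zu)
    (scal ((mink zu zu * mink w zv - mink zu zv * mink w zu) / gram z u v) zv).

Definition normal_part (z : R -> R -> R4) (u v : R) (w : R4) : R4 :=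
  minus w (tangent_part z u v w).

Definition is_tangent (z : R -> R -> R4) (u v : R) (w : R4) : Prop :=
  exists a b : R, w = plus (scal a (du z u v)) (scal b (dv z u v)).

Definition is_normal (z : R -> R -> R4) (u v : R) (w : R4) : Prop :=
  mink w (du z u v) = 0 /\ mink w (dv z u v) = 0.

Lemma mink_sym (a b : R4) : mink a b = mink b a.
Proof. unfold mink; ring. Qed.

Lemma mink_plus_l (a b c : R4) : mink (plus a b) c = mink a c + mink b c.
Proof.
change (plus a b) with (x1 a + x1 b, x2 a + x2 b, x3 a + x3 b, x4 a + x4 b).
unfold mink, x1, x2, x3, x4; simpl; ring.
Qed.

Lemma mink_scal_l (r : R) (a c : R4) : mink (scal r a) c = r * mink a c.
Proof.
change (scal r a) with (r * x1 a, r * x2 a, r * x3 a, r * x4 a).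
unfold mink, x1, x2, x3, x4; simpl; ring.
Qed.

Lemma mink_minus_l (a b c : R4) : mink (minus a b) c = mink a c - mink b c.
Proof.
change (minus a b)
  with (x1 a + - x1 b, x2 a + - x2 b, x3 a + - x3 b, x4 a + - x4 b).
unfold mink, x1, x2, x3, x4; simpl; ring.
Qed.

Lemma minus_minus (a b : R4) : minus a (minus a b) = b.
Proof.
change (minus a (minus a b))
  with (x1 a + - (x1 a + - x1 b), x2 a + - (x2 a + - x2 b),
        x3 a + - (x3 a + - x3 b), x4 a + - (x4 a + - x4 b)).
destruct b as [[[b1 b2] b3] b4]; unfold x1, x2, x3, x4; simpl.
repeat f_equal; ring.
Qed.

(** [normal_part] is the normal component in the decomposition of a vector
    into a tangent and a normal one (Weingarten formula). *)
Lemma normal_part_spec (z : R -> R -> R4) (u v : R) (w n : R4) :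
  gram z u v <> 0 ->
  (n = normal_part z u v w <->
   is_normal z u v n /\ is_tangent z u v (minus w n)).
Proof.
intros Hg.
assert (Hs := mink_sym (dv z u v) (du z u v)).
unfold normal_part, tangent_part, is_normal, is_tangent; cbv zeta.
split.
- intros ->; split.
  + rewrite !mink_minus_l, !mink_plus_l, !mink_scal_l, Hs.
    unfold gram in *; split; field; exact Hg.
  + rewrite minus_minus; eexists; eexists; reflexivity.
- intros [[Hu Hv] [p [q E]]].
  assert (Eu := f_equal (fun t => mink t (du z u v)) E).
  assert (Ev := f_equal (fun t => mink t (dv z u v)) E).
  simpl in Eu, Ev.
  rewrite mink_minus_l, mink_plus_l, !mink_scal_l, Hu, Rminus_0_r, Hs in Eu.
  rewrite mink_minus_l, mink_plus_l, !mink_scal_l, Hv, Rminus_0_r in Ev.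
  rewrite Eu, Ev.
  match goal with |- _ = minus w (plus (scal ?a _) (scal ?b _)) =>
    replace a with p by (unfold gram in *; field; exact Hg);
    replace b with q by (unfold gram in *; field; exact Hg)
  end.
  rewrite <- E; symmetry; apply minus_minus.
Qed.

Definition normal_conn (z : R -> R -> R4) (X : tfield) (N : R -> R -> R4)
    (u v : R) : R4 :=
  normal_part z u v (flat_conn X N u v).

Definition RD (z : R -> R -> R4) (X Y : tfield) (N : R -> R -> R4)
    (u v : R) : R4 :=
  minus (minus (normal_conn z X (normal_conn z Y N) u v)
               (normal_conn z Y (normal_conn z X N) u v))
        (normal_conn z (bracket X Y) N u v).

Definition normal_curvature (z : R -> R -> R4) (X Y : tfield)
    (N1 N2 : R -> R -> R4) (u v : R) : R :=
  mink (RD z X Y N1 u v) (N2 u v)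
  / (mink (push z X u v) (push z X u v) * mink (push z Y u v) (push z Y u v)
     - mink (push z X u v) (push z Y u v) ^ 2).

(** Unit vectors have square [1] or [-1]: the induced metric may be
    indefinite. *)
Definition orthonormal_tangent (z : R -> R -> R4) (X Y : tfield)
    (u v : R) : Prop :=
  Rabs (mink (push z X u v) (push z X u v)) = 1 /\
  Rabs (mink (push z Y u v) (push z Y u v)) = 1 /\
  mink (push z X u v) (push z Y u v) = 0.

(** The normal bundle is positive definite. *)
Definition orthonormal_normal (z : R -> R -> R4) (N1 N2 : R -> R -> R4)
    (u v : R) : Prop :=
  is_normal z u v (N1 u v) /\ is_normal z u v (N2 u v) /\
  mink (N1 u v) (N1 u v) = 1 /\ mink (N2 u v) (N2 u v) = 1 /\
  mink (N1 u v) (N2 u v) = 0.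

(** [k] is the value of the normal curvature at [(u, v)] computed with some
    smooth orthonormal frames defined around [(u, v)].  Changing the frames
    can only change the sign of [k]. *)
Definition is_normal_curvature (I J : R -> Prop) (z : R -> R -> R4)
    (u v k : R) : Prop :=
  exists (U : R * R -> Prop) (X Y : tfield) (N1 N2 : R -> R -> R4),
    open U /\ U (u, v) /\
    smooth2_on U (cu X) /\ smooth2_on U (cv X) /\
    smooth2_on U (cu Y) /\ smooth2_on U (cv Y) /\
    smooth2_vec_on U N1 /\ smooth2_vec_on U N2 /\
    (forall s t, U (s, t) -> I s -> J t ->
       orthonormal_tangent z X Y s t /\ orthonormal_normal z N1 N2 s t) /\
    k = normal_curvature z X Y N1 N2 u v.

(** The right-to-left half of the equivalence says that suitable frames exist
    around every point (in particular the surface is regular and timelike),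
    so that the left-to-right half is not vacuous. *)
Definition flat_normal_connection (I J : R -> Prop) (z : R -> R -> R4) : Prop :=
  forall u v, I u -> J v -> forall k, is_normal_curvature I J z u v k <-> k = 0.

Definition meridian (f g : R -> R) (l : R -> R4) (u v : R) : R4 :=
  plus (scal (f u) (l v)) (scal (g u) e1).

(* Main.v *)
Require Import Defs.
From Stdlib Require Import Reals Lra Lia.
From Coquelicot Require Import Coquelicot.
Open Scope R_scope.

(** The parameter lines of a meridian surface are its lines of curvature.  Since
    [z_u = f' l + g' e1] and [z_v = f l'], the mixed derivative
    [z_uv = f' l'] is tangent, and [z_u] is orthogonal to [z_v] because [l],
    [l'] and [e1] are mutually orthogonal.  The coordinate net is thus
    orthogonal and conjugate: every shape operator is diagonal in the frame
    [z_u, z_v], all shape operators commute, and the Ricci equation says that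
    the normal curvature is the commutator of shape operators.

    The Ricci equation enters as follows.  If [W_X] is the flat derivative of a
    normal field [N] along [X], then [D_X N] is [W_X] minus its tangent part, and
    the terms of [R^D(X, Y) N] built from second derivatives of [N] cancel by
    the symmetry of second partial derivatives ([flat_conn_commutator]).  What
    remains is made of derivatives of the tangent parts of [W_X] and [W_Y];
    paired with a normal vector these see only the coefficients of the tangent
    parts and the second derivatives of [z] ([mink_RD]).  Differentiating
    [<N, z_u> = 0 = <N, z_v>] turns the coefficients into second fundamental
    forms too, and for an orthogonal conjugate net the result is symmetric in
    [X] and [Y] ([RD_orthogonal_conjugate_net]).

    The parameter intervals may contain endpoints, and there the identities
    [<l, l> = 1], [<N, z_u> = 0], ... hold on one side only, while derivatives
    are two-sided.  A differentiable function that vanishes on an interval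
    still has zero derivative at every point of that interval
    ([Derive_zero_on_interval]), which is all that is needed, as both sides
    of the differentiated identities are smooth across the endpoint.

    Zero is also attained: normalising [z_u] and [z_v], and taking the Lorentzian
    cross product of [l] and [l'] together with the unit normal of the profile
    curve, gives smooth orthonormal frames near every point
    ([meridian_normal_curvature_exists]); the value of the normal curvature
    computed from them is zero by the first half. *)

(** * Vectors and curves in Minkowski space *)

Lemma R4_ext (a b : R4) :
  x1 a = x1 b -> x2 a = x2 b -> x3 a = x3 b -> x4 a = x4 b -> a = b.
Proof.
destruct a as [[[a1 a2] a3] a4], b as [[[b1 b2] b3] b4].
unfold x1, x2, x3, x4; simpl; intros -> -> -> ->; reflexivity.
Qed.

Lemma R4_plus (a b : R4) :
  plus a b = (x1 a + x1 b, x2 a + x2 b, x3 a + x3 b, x4 a + x4 b).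
Proof. reflexivity. Qed.

Lemma R4_scal (r : R) (a : R4) :
  scal r a = (r * x1 a, r * x2 a, r * x3 a, r * x4 a).
Proof. reflexivity. Qed.

Lemma R4_minus (a b : R4) :
  minus a b = (x1 a - x1 b, x2 a - x2 b, x3 a - x3 b, x4 a - x4 b).
Proof. reflexivity. Qed.

Lemma R4_zero : (zero : R4) = (0, 0, 0, 0).
Proof. reflexivity. Qed.

Ltac R4_unfold :=
  rewrite ?R4_plus, ?R4_scal, ?R4_minus, ?R4_zero;
  unfold mink, e1, e2, e3, e4, x1, x2, x3, x4; simpl.

Ltac R4_ring := apply R4_ext; R4_unfold; ring.

Lemma mink_plus_r a b c : mink c (plus a b) = mink c a + mink c b.
Proof. rewrite !(mink_sym c); apply mink_plus_l. Qed.

Lemma mink_scal_r r a c : mink c (scal r a) = r * mink c a.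
Proof. rewrite !(mink_sym c); apply mink_scal_l. Qed.

Definition is_vderive (w : R -> R4) (t : R) (d : R4) : Prop :=
  is_derive (fun s => x1 (w s)) t (x1 d) /\
  is_derive (fun s => x2 (w s)) t (x2 d) /\
  is_derive (fun s => x3 (w s)) t (x3 d) /\
  is_derive (fun s => x4 (w s)) t (x4 d).

Lemma is_vderive_unique w t d : is_vderive w t d -> vderive w t = d.
Proof.
intros (H1 & H2 & H3 & H4).
apply R4_ext; apply is_derive_unique; assumption.
Qed.

Lemma vderive_correct w t :
  ex_derive (fun s => x1 (w s)) t -> ex_derive (fun s => x2 (w s)) t ->
  ex_derive (fun s => x3 (w s)) t -> ex_derive (fun s => x4 (w s)) t ->
  is_vderive w t (vderive w t).
Proof.
intros H1 H2 H3 H4.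
split; [|split; [|split]]; apply Derive_correct; assumption.
Qed.

Lemma is_vderive_ext_loc a b t d :
  locally t (fun s => a s = b s) -> is_vderive a t d -> is_vderive b t d.
Proof.
intros E (H1 & H2 & H3 & H4).
split; [|split; [|split]];
  [ revert H1 | revert H2 | revert H3 | revert H4 ];
  apply is_derive_ext_loc; revert E; apply filter_imp;
  intros s ->; reflexivity.
Qed.

Lemma is_vderive_const a t : is_vderive (fun _ => a) t zero.
Proof. split; [|split; [|split]]; apply (is_derive_const (V := R_NormedModule)). Qed.

Lemma is_vderive_plus a b t a' b' :
  is_vderive a t a' -> is_vderive b t b' ->
  is_vderive (fun s => plus (a s) (b s)) t (plus a' b').
Proof.
intros (H1 & H2 & H3 & H4) (K1 & K2 & K3 & K4).
split; [|split; [|split]];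
  apply (is_derive_plus (V := R_NormedModule)); assumption.
Qed.

Lemma is_vderive_minus a b t a' b' :
  is_vderive a t a' -> is_vderive b t b' ->
  is_vderive (fun s => minus (a s) (b s)) t (minus a' b').
Proof.
intros (H1 & H2 & H3 & H4) (K1 & K2 & K3 & K4).
split; [|split; [|split]];
  apply (is_derive_minus (V := R_NormedModule)); assumption.
Qed.

Lemma is_vderive_scal (p : R -> R) (a : R -> R4) (t p' : R) (a' : R4) :
  is_derive p t p' -> is_vderive a t a' ->
  is_vderive (fun s => scal (p s) (a s)) t
    (plus (scal p' (a t)) (scal (p t) a')).
Proof.
intros H (K1 & K2 & K3 & K4).
split; [|split; [|split]];
  [ pose proof (K := K1) | pose proof (K := K2)
  | pose proof (K := K3) | pose proof (K := K4) ];
  exact (is_derive_mult _ _ _ _ _ H K Rmult_comm).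
Qed.

Lemma is_vderive_comb (p q : R -> R) (a b : R -> R4) (t : R) (a' b' : R4) :
  ex_derive p t -> ex_derive q t -> is_vderive a t a' -> is_vderive b t b' ->
  is_vderive (fun s => plus (scal (p s) (a s)) (scal (q s) (b s))) t
    (plus (plus (scal (Derive p t) (a t)) (scal (p t) a'))
          (plus (scal (Derive q t) (b t)) (scal (q t) b'))).
Proof.
intros Hp Hq Ha Hb.
apply is_vderive_plus; apply is_vderive_scal; try assumption;
  apply Derive_correct; assumption.
Qed.

Lemma is_derive_mink a b t a' b' :
  is_vderive a t a' -> is_vderive b t b' ->
  is_derive (fun s => mink (a s) (b s)) t (mink a' (b t) + mink (a t) b').
Proof.
intros (H1 & H2 & H3 & H4) (K1 & K2 & K3 & K4).
assert (M1 := is_derive_mult _ _ _ _ _ H1 K1 Rmult_comm).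
assert (M2 := is_derive_mult _ _ _ _ _ H2 K2 Rmult_comm).
assert (M3 := is_derive_mult _ _ _ _ _ H3 K3 Rmult_comm).
assert (M4 := is_derive_mult _ _ _ _ _ H4 K4 Rmult_comm).
assert (M := is_derive_minus _ _ _ _ _
  (is_derive_plus _ _ _ _ _ (is_derive_plus _ _ _ _ _ M1 M2) M3) M4).
refine (eq_ind _ (is_derive _ t) M _ _).
unfold mink, minus, plus, opp, mult; simpl; ring.
Qed.

(** * The Ricci equation *)

Definition has_partials (w : R -> R -> R4) (u v : R) : Prop :=
  is_vderive (fun s => w s v) u (du w u v) /\
  is_vderive (fun t => w u t) v (dv w u v).

Lemma has_partials_intro w u v a b :
  is_vderive (fun s => w s v) u a -> is_vderive (fun t => w u t) v b ->
  has_partials w u v /\ du w u v = a /\ dv w u v = b.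
Proof.
intros Ha Hb.
assert (Ea : du w u v = a) by exact (is_vderive_unique _ _ _ Ha).
assert (Eb : dv w u v = b) by exact (is_vderive_unique _ _ _ Hb).
unfold has_partials; rewrite Ea, Eb; repeat split; assumption || apply Ha || apply Hb.
Qed.

Lemma flat_conn_minus X a b u v :
  has_partials a u v -> has_partials b u v ->
  flat_conn X (fun s t => minus (a s t) (b s t)) u v
  = minus (flat_conn X a u v) (flat_conn X b u v).
Proof.
intros [Hau Hav] [Hbu Hbv].
assert (Eu := is_vderive_unique _ _ _ (is_vderive_minus _ _ _ _ _ Hau Hbu)).
assert (Ev := is_vderive_unique _ _ _ (is_vderive_minus _ _ _ _ _ Hav Hbv)).
unfold flat_conn, du at 1, dv at 1; rewrite Eu, Ev; R4_ring.
Qed.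

Lemma mink_normal_part z u v w n :
  is_normal z u v n -> mink (normal_part z u v w) n = mink w n.
Proof.
intros [Hu Hv]; unfold normal_part, tangent_part; cbv zeta.
rewrite mink_minus_l, mink_plus_l, !mink_scal_l.
rewrite (mink_sym (du z u v) n), (mink_sym (dv z u v) n), Hu, Hv; ring.
Qed.

(** With [tan_v], the coefficients of [tangent_part] in the frame [z_u, z_v], as
    functions on the parameter domain. They have to be differentiated along
    with [z_u] and [z_v]. *)
Definition tan_u (z : R -> R -> R4) (W : R -> R -> R4) (u v : R) : R :=
  (mink (dv z u v) (dv z u v) * mink (W u v) (du z u v)
   - mink (du z u v) (dv z u v) * mink (W u v) (dv z u v)) / gram z u v.

Definition tan_v (z : R -> R -> R4) (W : R -> R -> R4) (u v : R) : R :=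
  (mink (du z u v) (du z u v) * mink (W u v) (dv z u v)
   - mink (du z u v) (dv z u v) * mink (W u v) (du z u v)) / gram z u v.

(** The functions stand for the entries [<z_u, z_u>], [<z_v, z_v>],
    [<z_u, z_v>] of the Gram matrix and for [<W, z_u>], [<W, z_v>] along a
    parameter line; the quotients are then [tan_u] and [tan_v]. *)
Lemma ex_derive_gram_quotient (aa bb ab wa wb : R -> R) (t : R) :
  ex_derive aa t -> ex_derive bb t -> ex_derive ab t ->
  ex_derive wa t -> ex_derive wb t -> aa t * bb t - ab t ^ 2 <> 0 ->
  ex_derive (fun s => (bb s * wa s - ab s * wb s)
                      / (aa s * bb s - ab s ^ 2)) t /\
  ex_derive (fun s => (aa s * wb s - ab s * wa s)
                      / (aa s * bb s - ab s ^ 2)) t.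
Proof. intros; split; auto_derive; repeat split; assumption. Qed.

Lemma ex_derive_tan z W u v :
  has_partials (du z) u v -> has_partials (dv z) u v -> has_partials W u v ->
  gram z u v <> 0 ->
  ex_derive (fun s => tan_u z W s v) u /\ ex_derive (fun s => tan_v z W s v) u /\
  ex_derive (fun t => tan_u z W u t) v /\ ex_derive (fun t => tan_v z W u t) v.
Proof.
intros [Hu Hu'] [Hv Hv'] [Hw Hw'] Hg.
assert (D : forall a b t a' b', is_vderive a t a' -> is_vderive b t b' ->
            ex_derive (fun s => mink (a s) (b s)) t).
{ intros a b t a' b' Ha Hb; eexists; apply (is_derive_mink _ _ _ _ _ Ha Hb). }
destruct (ex_derive_gram_quotient
  (fun s => mink (du z s v) (du z s v)) (fun s => mink (dv z s v) (dv z s v))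
  (fun s => mink (du z s v) (dv z s v)) (fun s => mink (W s v) (du z s v))
  (fun s => mink (W s v) (dv z s v)) u
  (D _ _ _ _ _ Hu Hu) (D _ _ _ _ _ Hv Hv) (D _ _ _ _ _ Hu Hv)
  (D _ _ _ _ _ Hw Hu) (D _ _ _ _ _ Hw Hv) Hg) as [P1 P2].
destruct (ex_derive_gram_quotient
  (fun s => mink (du z u s) (du z u s)) (fun s => mink (dv z u s) (dv z u s))
  (fun s => mink (du z u s) (dv z u s)) (fun s => mink (W u s) (du z u s))
  (fun s => mink (W u s) (dv z u s)) v
  (D _ _ _ _ _ Hu' Hu') (D _ _ _ _ _ Hv' Hv') (D _ _ _ _ _ Hu' Hv')
  (D _ _ _ _ _ Hw' Hu') (D _ _ _ _ _ Hw' Hv') Hg) as [P3 P4].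
exact (conj P1 (conj P2 (conj P3 P4))).
Qed.

Lemma has_partials_tangent_part z W u v :
  has_partials (du z) u v -> has_partials (dv z) u v -> has_partials W u v ->
  gram z u v <> 0 ->
  has_partials (fun s t => tangent_part z s t (W s t)) u v.
Proof.
intros Hu Hv HW Hg.
destruct (ex_derive_tan z W u v Hu Hv HW Hg) as (P1 & P2 & P3 & P4).
destruct Hu as [Hu Hu'], Hv as [Hv Hv'].
assert (A := is_vderive_comb _ _ _ _ _ _ _ P1 P2 Hu Hv).
assert (B := is_vderive_comb _ _ _ _ _ _ _ P3 P4 Hu' Hv').
exact (proj1 (has_partials_intro (fun s t => tangent_part z s t (W s t)) _ _ _ _ A B)).
Qed.

(** By the Leibniz rule, the derivatives of the coefficients multiply the tangent
    vectors [z_u] and [z_v], which [n] does not see. *)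
Lemma mink_flat_conn_tangent_part X z W u v n :
  has_partials (du z) u v -> has_partials (dv z) u v -> has_partials W u v ->
  gram z u v <> 0 -> is_normal z u v n ->
  mink (flat_conn X (fun s t => tangent_part z s t (W s t)) u v) n
  = tan_u z W u v * mink (flat_conn X (du z) u v) n
    + tan_v z W u v * mink (flat_conn X (dv z) u v) n.
Proof.
intros Hu Hv HW Hg [Nu Nv].
destruct (ex_derive_tan z W u v Hu Hv HW Hg) as (P1 & P2 & P3 & P4).
destruct Hu as [Hu Hu'], Hv as [Hv Hv'].
assert (A := is_vderive_unique _ _ _ (is_vderive_comb _ _ _ _ _ _ _ P1 P2 Hu Hv)).
assert (B := is_vderive_unique _ _ _ (is_vderive_comb _ _ _ _ _ _ _ P3 P4 Hu' Hv')).
assert (A' : du (fun s t => tangent_part z s t (W s t)) u v = _) by exact A.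
assert (B' : dv (fun s t => tangent_part z s t (W s t)) u v = _) by exact B.
unfold flat_conn; rewrite A', B'.
rewrite !mink_plus_l, !mink_scal_l, !mink_plus_l, !mink_scal_l.
rewrite (mink_sym (du z u v) n), (mink_sym (dv z u v) n), Nu, Nv; ring.
Qed.

(** The Ricci equation. Writing [D_Y N] as [W_Y] minus its tangent part and
    pairing with [n], which absorbs the outer normal projections, the terms in
    [W_X] and [W_Y] add up to zero by the commutator hypothesis. *)
Lemma mink_RD z X Y N u v n :
  has_partials (du z) u v -> has_partials (dv z) u v ->
  has_partials (flat_conn X N) u v -> has_partials (flat_conn Y N) u v ->
  minus (flat_conn X (flat_conn Y N) u v) (flat_conn Y (flat_conn X N) u v)
  = flat_conn (bracket X Y) N u v ->
  gram z u v <> 0 -> is_normal z u v n ->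
  mink (RD z X Y N u v) n
  = tan_u z (flat_conn X N) u v * mink (flat_conn Y (du z) u v) n
    + tan_v z (flat_conn X N) u v * mink (flat_conn Y (dv z) u v) n
    - tan_u z (flat_conn Y N) u v * mink (flat_conn X (du z) u v) n
    - tan_v z (flat_conn Y N) u v * mink (flat_conn X (dv z) u v) n.
Proof.
intros Hu Hv HX HY HB Hg Hn.
assert (TX := has_partials_tangent_part z _ u v Hu Hv HX Hg).
assert (TY := has_partials_tangent_part z _ u v Hu Hv HY Hg).
unfold RD; rewrite !mink_minus_l.
unfold normal_conn at 1 3 5; rewrite !mink_normal_part by exact Hn.
assert (EY : flat_conn X (normal_conn z Y N) u v = _)
  by exact (flat_conn_minus X _ _ u v HY TY).
assert (EX : flat_conn Y (normal_conn z X N) u v = _)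
  by exact (flat_conn_minus Y _ _ u v HX TX).
rewrite EX, EY, !mink_minus_l, !mink_flat_conn_tangent_part by assumption.
rewrite <- HB, mink_minus_l; ring.
Qed.

(** When [<z_u, z_v> = 0] and the mixed second derivatives have no normal
    component, the right-hand side of [mink_RD] is a sum of
    [X^u Y^u <N_u, z_u> <z_uu, n> / <z_u, z_u>] and
    [X^v Y^v <N_v, z_v> <z_vv, n> / <z_v, z_v>], minus the same with [X] and [Y]
    exchanged. *)
Lemma RD_orthogonal_conjugate_net z X Y N u v n :
  has_partials (du z) u v -> has_partials (dv z) u v ->
  has_partials (flat_conn X N) u v -> has_partials (flat_conn Y N) u v ->
  minus (flat_conn X (flat_conn Y N) u v) (flat_conn Y (flat_conn X N) u v)
  = flat_conn (bracket X Y) N u v ->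
  gram z u v <> 0 -> is_normal z u v n ->
  mink (du z u v) (dv z u v) = 0 ->
  mink (dv (du z) u v) n = 0 -> mink (du (dv z) u v) n = 0 ->
  mink (dv N u v) (du z u v) = 0 -> mink (du N u v) (dv z u v) = 0 ->
  mink (RD z X Y N u v) n = 0.
Proof.
intros Hu Hv HX HY HB Hg Hn F Huv Hvu Nvu Nuv.
rewrite mink_RD by assumption.
unfold tan_u, tan_v, gram in *; unfold flat_conn.
rewrite !mink_plus_l, !mink_scal_l, F, Huv, Hvu, Nvu, Nuv.
rewrite F in Hg; field.
split; intros E; apply Hg; rewrite E; ring.
Qed.

(** * Smooth functions of one variable *)

(** Bounded order of differentiability, so that smoothness can be proved by
    induction on the order. *)
Definition Cn (O : R -> Prop) (n : nat) (a : R -> R) : Prop :=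
  forall t, O t -> forall k, (k <= n)%nat -> ex_derive_n a k t.

(** The recursive description of [Cn], peeling off the innermost derivative
    rather than the outermost one. *)
Lemma Cn_S O n a :
  Cn O (S n) a <-> (forall t, O t -> ex_derive a t) /\ Cn O n (Derive a).
Proof.
assert (E : forall k x, Derive_n (Derive a) k x = Derive_n a (S k) x).
{ intros k x; change (Derive a) with (Derive_n a 1).
  rewrite Derive_n_comp; f_equal; lia. }
split.
- intros Ha; split; [intros t Ht; apply (Ha t Ht 1%nat); lia|].
  intros t Ht [|k] Hk; [exact I|].
  apply ex_derive_ext with (Derive_n a (S k)); [intros x; symmetry; apply E|].
  apply (Ha t Ht (S (S k))); lia.
- intros [H0 H1] t Ht [|[|k]] Hk; [exact I | apply H0; exact Ht |].
  apply ex_derive_ext with (Derive_n (Derive a) k); [intros x; apply E|].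
  apply (H1 t Ht (S k)); lia.
Qed.

Lemma Cn_ext O n a b :
  open O -> (forall t, O t -> a t = b t) -> Cn O n a -> Cn O n b.
Proof.
intros HO E Ha t Ht k Hk; apply ex_derive_n_ext_loc with a.
- exact (locally_open _ _ HO E t Ht).
- apply Ha; assumption.
Qed.

Lemma Cn_le O m n a : (m <= n)%nat -> Cn O n a -> Cn O m a.
Proof. intros Hmn Ha t Ht k Hk; apply Ha; [assumption | lia]. Qed.

Lemma Cn_plus O n a b :
  open O -> Cn O n a -> Cn O n b -> Cn O n (fun t => a t + b t).
Proof.
intros HO Ha Hb t Ht k Hk; apply ex_derive_n_plus;
  apply (locally_open O); try assumption;
  intros s Hs j Hj; [apply Ha | apply Hb]; try assumption; lia.
Qed.

(** By induction: [(a b)' = a' b + a b'] only involves products of functions of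
    one order less. *)
Lemma Cn_mult O n a b :
  open O -> Cn O n a -> Cn O n b -> Cn O n (fun t => a t * b t).
Proof.
intros HO; revert a b; induction n as [|n IH]; intros a b Ha Hb.
- intros t _ k Hk; replace k with 0%nat by lia; exact I.
- assert (Ha0 := Cn_le O n (S n) a (Nat.le_succ_diag_r n) Ha).
  assert (Hb0 := Cn_le O n (S n) b (Nat.le_succ_diag_r n) Hb).
  apply Cn_S in Ha; apply Cn_S in Hb; destruct Ha as [Da Ha], Hb as [Db Hb].
  apply Cn_S; split; [intros t Ht; apply ex_derive_mult; auto|].
  apply Cn_ext with (fun t => Derive a t * b t + a t * Derive b t);
    [assumption | intros t Ht; symmetry; apply Derive_mult; auto |].
  apply Cn_plus; [assumption | |]; apply IH; assumption.
Qed.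

Lemma Cn_const O n c : Cn O n (fun _ => c).
Proof. intros t _ k _; apply ex_derive_n_const. Qed.

(** The function [r = / sqrt h] satisfies [r' = - h' r^3 / 2], so it gains one
    order of differentiability from knowing its own lower order. *)
Lemma Cn_inv_sqrt O n h :
  open O -> (forall t, O t -> 0 < h t) -> Cn O n h ->
  Cn O n (fun t => / sqrt (h t)).
Proof.
intros HO Hpos; induction n as [|n IH]; intros Hh.
- intros t _ k Hk; replace k with 0%nat by lia; exact I.
- assert (Hr := IH (Cn_le O n (S n) h (Nat.le_succ_diag_r n) Hh)).
  apply Cn_S in Hh; destruct Hh as [Dh Hh].
  set (r := fun t => / sqrt (h t)) in *.
  assert (Dr : forall t, O t ->
    is_derive r t (- (1/2) * (Derive h t * (r t * (r t * r t))))).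
  { intros t Ht; assert (P := Hpos t Ht); unfold r; auto_derive.
    - repeat split; [apply Dh; exact Ht | exact P |].
      apply Rgt_not_eq, sqrt_lt_R0; exact P.
    - change (Derive (fun x => h x) t) with (Derive h t).
      assert (Q := sqrt_lt_R0 _ P); field; lra. }
  apply Cn_S; split; [intros t Ht; eexists; apply Dr; exact Ht|].
  apply Cn_ext with (fun t => - (1/2) * (Derive h t * (r t * (r t * r t))));
    [assumption | intros t Ht; symmetry; apply is_derive_unique, Dr, Ht |].
  apply (Cn_mult O n (fun _ => - (1/2))); [assumption | apply Cn_const |].
  apply (Cn_mult O n (Derive h)); [assumption | assumption |].
  apply (Cn_mult O n r); [assumption | assumption |].
  apply Cn_mult; assumption.
Qed.

Definition smooth (O : R -> Prop) (a : R -> R) : Prop :=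
  forall t, O t -> forall n, ex_derive_n a n t.

Lemma smooth_Cn O a : smooth O a <-> forall n, Cn O n a.
Proof.
split; [intros H n t Ht k _; exact (H t Ht k)|].
intros H t Ht n; exact (H n t Ht n (Nat.le_refl n)).
Qed.

Lemma smooth_plus O a b :
  open O -> smooth O a -> smooth O b -> smooth O (fun t => a t + b t).
Proof. rewrite !smooth_Cn; intros; apply Cn_plus; auto. Qed.

Lemma smooth_mult O a b :
  open O -> smooth O a -> smooth O b -> smooth O (fun t => a t * b t).
Proof. rewrite !smooth_Cn; intros; apply Cn_mult; auto. Qed.

Lemma smooth_inv_sqrt O h :
  open O -> (forall t, O t -> 0 < h t) -> smooth O h ->
  smooth O (fun t => / sqrt (h t)).
Proof. rewrite !smooth_Cn; intros; apply Cn_inv_sqrt; auto. Qed.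

Lemma smooth_const O c : smooth O (fun _ => c).
Proof. apply smooth_Cn; intros n; apply Cn_const. Qed.

Lemma ex_derive_n_Derive (a : R -> R) t :
  (forall k, ex_derive_n a k t) -> forall k, ex_derive_n (Derive a) k t.
Proof.
intros Ha [|k]; [exact I|].
apply ex_derive_ext with (2 := Ha (S (S k))).
intros x; symmetry; change (Derive a) with (Derive_n a 1).
rewrite Derive_n_comp; f_equal; lia.
Qed.

Lemma smooth_Derive O a : smooth O a -> smooth O (Derive a).
Proof. intros H t Ht; apply ex_derive_n_Derive, H, Ht. Qed.

Lemma smooth_opp O a : smooth O a -> smooth O (fun t => - a t).
Proof. intros H t Ht n; apply ex_derive_n_opp, H, Ht. Qed.

Lemma open_positive (O : R -> Prop) h :
  open O -> smooth O h -> open (fun t => O t /\ 0 < h t).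
Proof.
intros HO Hh t [Ot Pt]; apply filter_and; [exact (HO t Ot)|].
apply (ex_derive_continuous h t (Hh t Ot 1%nat) (fun y => 0 < y)).
exact (open_gt 0 (h t) Pt).
Qed.

(** * Smooth functions of two variables *)

(** The product form is preserved by both partial derivatives, without any
    differentiability assumption, so the induction stays at the point [(u, v)]. *)
Lemma ex_diff_n_prod n : forall (a b : R -> R) (u v : R),
  (forall k, ex_derive_n a k u) -> (forall k, ex_derive_n b k v) ->
  ex_diff_n (fun s t => a s * b t) n u v.
Proof.
assert (C : forall a b u v, (forall k, ex_derive_n a k u) ->
  (forall k, ex_derive_n b k v) ->
  continuity_2d_pt (fun s t => a s * b t) u v).
{ intros a b u v Ha Hb; apply continuity_2d_pt_mult.
  - apply (continuity_1d_2d_pt_comp a (fun s _ => s));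
      [ apply continuity_pt_filterlim; apply (ex_derive_continuous a), (Ha 1%nat)
      | apply continuity_2d_pt_id1 ].
  - apply (continuity_1d_2d_pt_comp b (fun _ t => t));
      [ apply continuity_pt_filterlim; apply (ex_derive_continuous b), (Hb 1%nat)
      | apply continuity_2d_pt_id2 ]. }
induction n as [|n IH]; intros a b u v Ha Hb; simpl.
- split; [apply C; assumption | exact I].
- split; [apply C; assumption|].
  split; [|split; [|split]].
  + apply ex_derive_mult; [apply (Ha 1%nat) | apply ex_derive_const].
  + apply ex_derive_mult; [apply ex_derive_const | apply (Hb 1%nat)].
  + apply ex_diff_n_ext_loc with (fun s t => Derive a s * b t).
    * apply locally_2d_forall; intros s t; symmetry; apply Derive_scal_l.
    * apply IH; [apply ex_derive_n_Derive|]; assumption.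
  + apply ex_diff_n_ext_loc with (fun s t => a s * Derive b t).
    * apply locally_2d_forall; intros s t; symmetry; apply Derive_scal.
    * apply IH; [|apply ex_derive_n_Derive]; assumption.
Qed.

Lemma smooth2_prod A B (a b : R -> R) (c : R -> R -> R) :
  (forall s t, a s * b t = c s t) -> smooth A a -> smooth B b ->
  smooth2_on (fun p => A (fst p) /\ B (snd p)) c.
Proof.
intros E Ha Hb u v [Au Bv] n.
apply ex_diff_n_ext_loc with (fun s t => a s * b t).
- apply locally_2d_forall; exact E.
- apply ex_diff_n_prod; [apply Ha, Au | apply Hb, Bv].
Qed.

Lemma smooth2_partials U a :
  smooth2_on U a ->
  smooth2_on U (fun u v => Derive (fun s => a s v) u) /\
  smooth2_on U (fun u v => Derive (fun t => a u t) v).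
Proof.
intros Ha; split; intros u v Huv n; apply (Ha u v Huv (S n)).
Qed.

Lemma smooth2_ex_derive U a u v :
  smooth2_on U a -> U (u, v) ->
  ex_derive (fun s => a s v) u /\ ex_derive (fun t => a u t) v.
Proof.
intros Ha Huv; destruct (Ha u v Huv 1%nat) as (_ & H1 & H2 & _); auto.
Qed.

Lemma smooth2_Schwarz U a u v :
  open U -> smooth2_on U a -> U (u, v) ->
  Derive (fun s => Derive (fun t => a s t) v) u
  = Derive (fun t => Derive (fun s => a s t) u) v.
Proof.
intros HU Ha Huv.
destruct (smooth2_partials U a Ha) as [Hau Hav].
apply Schwarz.
- apply locally_2d_locally.
  generalize (HU (u, v) Huv); apply filter_imp; intros [s t] Hst; simpl.
  destruct (smooth2_ex_derive U _ s t Ha Hst).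
  destruct (smooth2_ex_derive U _ s t Hau Hst).
  destruct (smooth2_ex_derive U _ s t Hav Hst).
  repeat split; assumption.
- apply (proj1 (smooth2_partials U _ Hav) u v Huv 0%nat).
- apply (proj2 (smooth2_partials U _ Hau) u v Huv 0%nat).
Qed.

Lemma ex_derive_dir_deriv U X a u v :
  smooth2_on U (cu X) -> smooth2_on U (cv X) -> smooth2_on U a -> U (u, v) ->
  ex_derive (fun s => dir_deriv X a s v) u /\
  ex_derive (fun t => dir_deriv X a u t) v.
Proof.
intros HXu HXv Ha Huv.
destruct (smooth2_partials U a Ha) as [Hau Hav].
destruct (smooth2_ex_derive U _ u v HXu Huv).
destruct (smooth2_ex_derive U _ u v HXv Huv).
destruct (smooth2_ex_derive U _ u v Hau Huv).
destruct (smooth2_ex_derive U _ u v Hav Huv).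
unfold dir_deriv.
split; apply (ex_derive_plus (V := R_NormedModule)); apply ex_derive_mult; assumption.
Qed.

(** The derivatives of the coefficients of [X] and [Y] give the bracket, and the
    second derivatives of [a] cancel by Schwarz. *)
Lemma dir_deriv_commutator U X Y a u v :
  open U -> smooth2_on U (cu X) -> smooth2_on U (cv X) ->
  smooth2_on U (cu Y) -> smooth2_on U (cv Y) -> smooth2_on U a -> U (u, v) ->
  dir_deriv X (dir_deriv Y a) u v - dir_deriv Y (dir_deriv X a) u v
  = dir_deriv (bracket X Y) a u v.
Proof.
intros HU HXu HXv HYu HYv Ha Huv.
destruct (smooth2_partials U a Ha) as [Hau Hav].
destruct (smooth2_ex_derive U _ u v HXu Huv).
destruct (smooth2_ex_derive U _ u v HXv Huv).
destruct (smooth2_ex_derive U _ u v HYu Huv).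
destruct (smooth2_ex_derive U _ u v HYv Huv).
destruct (smooth2_ex_derive U _ u v Hau Huv).
destruct (smooth2_ex_derive U _ u v Hav Huv).
assert (S := smooth2_Schwarz U a u v HU Ha Huv).
unfold bracket, dir_deriv; simpl.
rewrite !Derive_plus by (apply ex_derive_mult; assumption).
rewrite !Derive_mult by assumption.
change (Derive (fun s => cu X u s) v) with (Derive (cu X u) v).
change (Derive (fun s => cv X u s) v) with (Derive (cv X u) v).
change (Derive (fun s => cu Y u s) v) with (Derive (cu Y u) v).
change (Derive (fun s => cv Y u s) v) with (Derive (cv Y u) v).
rewrite S; ring.
Qed.

Lemma has_partials_flat_conn U X N u v :
  smooth2_on U (cu X) -> smooth2_on U (cv X) -> smooth2_vec_on U N ->
  U (u, v) -> has_partials (flat_conn X N) u v.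
Proof.
intros HXu HXv (H1 & H2 & H3 & H4) Huv.
split; apply vderive_correct;
  first [ apply (ex_derive_dir_deriv U X _ u v HXu HXv H1 Huv)
        | apply (ex_derive_dir_deriv U X _ u v HXu HXv H2 Huv)
        | apply (ex_derive_dir_deriv U X _ u v HXu HXv H3 Huv)
        | apply (ex_derive_dir_deriv U X _ u v HXu HXv H4 Huv) ].
Qed.

Lemma flat_conn_commutator U X Y N u v :
  open U -> smooth2_on U (cu X) -> smooth2_on U (cv X) ->
  smooth2_on U (cu Y) -> smooth2_on U (cv Y) -> smooth2_vec_on U N ->
  U (u, v) ->
  minus (flat_conn X (flat_conn Y N) u v) (flat_conn Y (flat_conn X N) u v)
  = flat_conn (bracket X Y) N u v.
Proof.
intros HU HXu HXv HYu HYv (H1 & H2 & H3 & H4) Huv.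
apply R4_ext.
- exact (dir_deriv_commutator U X Y _ u v HU HXu HXv HYu HYv H1 Huv).
- exact (dir_deriv_commutator U X Y _ u v HU HXu HXv HYu HYv H2 Huv).
- exact (dir_deriv_commutator U X Y _ u v HU HXu HXv HYu HYv H3 Huv).
- exact (dir_deriv_commutator U X Y _ u v HU HXu HXv HYu HYv H4 Huv).
Qed.

Lemma smooth2_has_partials U N u v :
  smooth2_vec_on U N -> U (u, v) -> has_partials N u v.
Proof.
intros (H1 & H2 & H3 & H4) Huv.
destruct (smooth2_ex_derive U _ u v H1 Huv).
destruct (smooth2_ex_derive U _ u v H2 Huv).
destruct (smooth2_ex_derive U _ u v H3 Huv).
destruct (smooth2_ex_derive U _ u v H4 Huv).
split; apply vderive_correct; assumption.
Qed.

Lemma open_slices (U : R * R -> Prop) u v :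
  open U -> U (u, v) ->
  locally u (fun s => U (s, v)) /\ locally v (fun t => U (u, t)).
Proof.
intros HU Huv; destruct (HU (u, v) Huv) as [eps Heps].
split; exists eps; intros s Hs; apply Heps; split; simpl;
  try exact Hs; apply ball_center.
Qed.

Lemma open_prod (A B : R -> Prop) :
  open A -> open B -> open (fun p : R * R => A (fst p) /\ B (snd p)).
Proof.
intros HA HB; apply open_and.
- apply (open_comp (@fst R R) A); [|exact HA].
  intros p _; apply continuous_fst.
- apply (open_comp (@snd R R) B); [|exact HB].
  intros p _; apply continuous_snd.
Qed.

(** * Identities on intervals with endpoints *)

(** At an endpoint of [I] the difference quotients from inside [I] vanish, and
    they determine the two-sided derivative because it is assumed to exist. *)
Lemma Derive_zero_on_interval (I : R -> Prop) (h : R -> R) (t : R) :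
  interval I -> I t -> ex_derive h t ->
  locally t (fun s => I s -> h s = 0) -> Derive h t = 0.
Proof.
intros [HI (x & y & Ix & Iy & Hxy)] It Hh [eps Heps].
destruct (Req_dec (Derive h t) 0) as [E|E]; [exact E|exfalso].
assert (Dh := proj1 (is_derive_Reals _ _ _) (Derive_correct h t Hh)).
destruct (Dh (Rabs (Derive h t)) (Rabs_pos_lt _ E)) as [delta Hdelta].
assert (H : exists w, I w /\ w <> t).
{ destruct (Req_dec x t) as [->|N]; [exists y; split; [exact Iy | lra]|].
  exists x; auto. }
destruct H as (w & Iw & Hw).
(* m bounds the increments allowed both by the neighbourhood where h vanishes
   on I and by the definition of the derivative. *)
set (m := Rmin eps delta).
assert (Hm : 0 < m) by (apply Rmin_pos; [apply eps | apply delta]).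
assert (Hk : exists k, k <> 0 /\ Rabs k < m /\ I (t + k)).
{ destruct (Rle_lt_dec t w) as [L|L].
  - exists (Rmin (m / 2) (w - t)).
    assert (0 < Rmin (m / 2) (w - t)) by (apply Rmin_pos; lra).
    assert (A := Rmin_l (m / 2) (w - t)); assert (B := Rmin_r (m / 2) (w - t)).
    repeat split; [lra | rewrite Rabs_right; lra |].
    apply (HI t w); try assumption; lra.
  - exists (- Rmin (m / 2) (t - w)).
    assert (0 < Rmin (m / 2) (t - w)) by (apply Rmin_pos; lra).
    assert (A := Rmin_l (m / 2) (t - w)); assert (B := Rmin_r (m / 2) (t - w)).
    repeat split; [lra | rewrite Rabs_left; lra |].
    apply (HI w t); try assumption; lra. }
destruct Hk as (k & K0 & Km & Ik).
assert (A := Rmin_l eps delta); assert (B := Rmin_r eps delta); fold m in A, B.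
assert (Z1 : h (t + k) = 0).
{ apply Heps; [|exact Ik].
  change (Rabs (t + k - t) < eps); replace (t + k - t) with k by ring; lra. }
assert (Z0 : h t = 0) by (apply Heps; [apply ball_center | exact It]).
assert (C := Hdelta k K0 ltac:(lra)).
rewrite Z1, Z0 in C; replace ((0 - 0) / k - Derive h t) with (- Derive h t) in C
  by (field; exact K0).
rewrite Rabs_Ropp in C; lra.
Qed.

(** Differentiating [<N, z_u> = 0] in [v] and [<N, z_v> = 0] in [u]. For a surface
    with tangent mixed derivatives this makes the shape operators diagonal. *)
Lemma normal_field_partials (I J : R -> Prop) U z N u v :
  interval I -> interval J -> I u -> J v -> open U -> U (u, v) ->
  has_partials N u v -> has_partials (du z) u v -> has_partials (dv z) u v ->
  (forall s t, U (s, t) -> I s -> J t -> is_normal z s t (N s t)) ->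
  mink (dv N u v) (du z u v) = - mink (N u v) (dv (du z) u v) /\
  mink (du N u v) (dv z u v) = - mink (N u v) (du (dv z) u v).
Proof.
intros HI HJ Iu Jv HU Huv [Nu Nv] [_ Huv'] [Hvu _] Hn.
destruct (open_slices U u v HU Huv) as [Su Sv].
assert (P := is_derive_mink _ _ _ _ _ Nv Huv').
assert (Q := is_derive_mink _ _ _ _ _ Nu Hvu).
assert (P0 : Derive (fun t => mink (N u t) (du z u t)) v = 0).
{ apply (Derive_zero_on_interval J); try assumption; [eexists; exact P|].
  revert Sv; apply filter_imp; intros t Ht Jt; apply (Hn u t); assumption. }
assert (Q0 : Derive (fun s => mink (N s v) (dv z s v)) u = 0).
{ apply (Derive_zero_on_interval I); try assumption; [eexists; exact Q|].
  revert Su; apply filter_imp; intros s Hs Is; apply (Hn s v); assumption. }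
apply (eq_trans (eq_sym (is_derive_unique _ _ _ P))) in P0.
apply (eq_trans (eq_sym (is_derive_unique _ _ _ Q))) in Q0.
split; lra.
Qed.

(** * Derivatives and metric of a meridian surface *)

Definition smooth_curve (O : R -> Prop) (l : R -> R4) : Prop :=
  smooth O (fun t => x1 (l t)) /\ smooth O (fun t => x2 (l t)) /\
  smooth O (fun t => x3 (l t)) /\ smooth O (fun t => x4 (l t)).

Lemma smooth_curve_neighbourhood J l :
  smooth_curve_on J l ->
  exists B, open B /\ (forall t, J t -> B t) /\ smooth_curve B l.
Proof.
intros ((B1 & O1 & J1 & S1) & (B2 & O2 & J2 & S2) &
        (B3 & O3 & J3 & S3) & (B4 & O4 & J4 & S4)).
exists (fun t => (B1 t /\ B2 t) /\ (B3 t /\ B4 t)).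
split; [repeat apply open_and; assumption|].
split; [intros t Jt; repeat split; auto|].
repeat split; intros t [[T1 T2] [T3 T4]] n; auto.
Qed.

Lemma smooth_curve_vderive B l t :
  smooth_curve B l -> B t ->
  is_vderive l t (vderive l t) /\
  is_vderive (vderive l) t (vderive (vderive l) t).
Proof.
intros (H1 & H2 & H3 & H4) Bt; split; apply vderive_correct.
- exact (H1 t Bt 1%nat).
- exact (H2 t Bt 1%nat).
- exact (H3 t Bt 1%nat).
- exact (H4 t Bt 1%nat).
- exact (H1 t Bt 2%nat).
- exact (H2 t Bt 2%nat).
- exact (H3 t Bt 2%nat).
- exact (H4 t Bt 2%nat).
Qed.

(** The curve stays in [span {e2, e3, e4}] and on the unit quadric; differentiating
    both conditions puts [l'] in the same space and orthogonal to [l]. *)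
Lemma deSitter_curve_frame J l v :
  interval J -> (forall t, J t -> deSitter2 (l t)) -> J v ->
  is_vderive l v (vderive l v) ->
  x1 (l v) = 0 /\ mink (l v) (l v) = 1 /\
  x1 (vderive l v) = 0 /\ mink (l v) (vderive l v) = 0.
Proof.
intros HJ HS Jv Hl.
assert (X : forall t, J t -> x1 (l t) = 0).
{ intros t Jt; destruct (HS t Jt) as [(a & b & c & ->) _]; R4_unfold; ring. }
split; [exact (X v Jv)|].
split; [exact (proj2 (HS v Jv))|].
split.
- apply (Derive_zero_on_interval J); try assumption.
  + exists (x1 (vderive l v)); exact (proj1 Hl).
  + apply filter_forall; exact X.
- assert (P := is_derive_mink _ _ _ _ _ Hl Hl).
  assert (Q := is_derive_minus _ _ _ _ _ P (is_derive_const 1 v)).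
  assert (D : Derive (fun t => minus (mink (l t) (l t)) 1) v = 0).
  { apply (Derive_zero_on_interval J); try assumption; [eexists; exact Q|].
    apply filter_forall; intros t Jt; rewrite (proj2 (HS t Jt)).
    apply Rminus_diag_eq; reflexivity. }
  assert (E := eq_trans (eq_sym (is_derive_unique _ _ _ Q)) D).
  revert E; unfold minus, plus, opp, zero; simpl.
  rewrite (mink_sym (vderive l v)); lra.
Qed.

Lemma du_meridian f g l u v :
  ex_derive f u -> ex_derive g u ->
  du (meridian f g l) u v
  = plus (scal (Derive f u) (l v)) (scal (Derive g u) e1).
Proof.
intros Hf Hg.
assert (H := is_vderive_comb f g _ _ u _ _ Hf Hg
  (is_vderive_const (l v) u) (is_vderive_const e1 u)).
assert (E : du (meridian f g l) u v = _) by exact (is_vderive_unique _ _ _ H).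
rewrite E; R4_ring.
Qed.

Lemma dv_meridian f g l u v :
  is_vderive l v (vderive l v) ->
  dv (meridian f g l) u v = scal (f u) (vderive l v).
Proof.
intros Hl.
assert (H := is_vderive_comb (fun _ => f u) (fun _ => g u) _ _ v _ _
  (ex_derive_const _ _) (ex_derive_const _ _) Hl (is_vderive_const e1 v)).
assert (E : dv (meridian f g l) u v = _) by exact (is_vderive_unique _ _ _ H).
rewrite E, !Derive_const; R4_ring.
Qed.

(** Both mixed derivatives equal [f' l'], a multiple of [z_v]: this is the
    conjugacy of the coordinate net. *)
Lemma meridian_second_partials f g l A B u v :
  open A -> open B ->
  smooth A f -> smooth A g -> smooth_curve B l ->
  A u -> B v ->
  has_partials (du (meridian f g l)) u v /\
  has_partials (dv (meridian f g l)) u v /\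
  dv (du (meridian f g l)) u v = scal (Derive f u) (vderive l v) /\
  du (dv (meridian f g l)) u v = scal (Derive f u) (vderive l v).
Proof.
intros HA HB Hf Hg Hl Au Bv.
set (z := meridian f g l).
destruct (smooth_curve_vderive B l v Hl Bv) as [Hl1 Hl2].
assert (Euu : locally u (fun s =>
  plus (scal (Derive f s) (l v)) (scal (Derive g s) e1) = du z s v)).
{ apply (locally_open A); try assumption; intros s As; symmetry.
  apply du_meridian; [apply (Hf s As 1%nat) | apply (Hg s As 1%nat)]. }
assert (Euv : locally v (fun t =>
  plus (scal (Derive f u) (l t)) (scal (Derive g u) e1) = du z u t)).
{ apply filter_forall; intros t; symmetry.
  apply du_meridian; [apply (Hf u Au 1%nat) | apply (Hg u Au 1%nat)]. }
assert (Evu : locally u (fun s => scal (f s) (vderive l v) = dv z s v)).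
{ apply filter_forall; intros s; symmetry; apply dv_meridian, Hl1. }
assert (Evv : locally v (fun t => scal (f u) (vderive l t) = dv z u t)).
{ apply (locally_open B); try assumption; intros t Bt; symmetry.
  exact (dv_meridian f g l u t (proj1 (smooth_curve_vderive B l t Hl Bt))). }
assert (Duu := is_vderive_ext_loc _ _ _ _ Euu
  (is_vderive_comb (Derive f) (Derive g) _ _ u _ _ (Hf u Au 2%nat) (Hg u Au 2%nat)
     (is_vderive_const (l v) u) (is_vderive_const e1 u))).
assert (Duv := is_vderive_ext_loc _ _ _ _ Euv
  (is_vderive_comb (fun _ => Derive f u) (fun _ => Derive g u) _ _ v _ _
     (ex_derive_const _ _) (ex_derive_const _ _) Hl1 (is_vderive_const e1 v))).
assert (Dvu := is_vderive_ext_loc _ _ _ _ Evu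
  (is_vderive_scal f _ u _ _ (Derive_correct f u (Hf u Au 1%nat))
     (is_vderive_const (vderive l v) u))).
assert (Dvv := is_vderive_ext_loc _ _ _ _ Evv
  (is_vderive_scal (fun _ => f u) _ v _ _ (is_derive_const (f u) v) Hl2)).
destruct (has_partials_intro _ _ _ _ _ Duu Duv) as (P1 & _ & P2).
destruct (has_partials_intro _ _ _ _ _ Dvu Dvv) as (Q1 & Q2 & _).
split; [exact P1|]; split; [exact Q1|]; split.
- rewrite P2, !Derive_const; R4_ring.
- rewrite Q2; R4_ring.
Qed.

Lemma meridian_metric f g l u v :
  ex_derive f u -> ex_derive g u -> is_vderive l v (vderive l v) ->
  x1 (l v) = 0 -> mink (l v) (l v) = 1 -> x1 (vderive l v) = 0 ->
  mink (l v) (vderive l v) = 0 -> mink (vderive l v) (vderive l v) = -1 ->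
  let z := meridian f g l in
  mink (du z u v) (du z u v) = Derive f u ^ 2 + Derive g u ^ 2 /\
  mink (du z u v) (dv z u v) = 0 /\
  mink (dv z u v) (dv z u v) = - f u ^ 2.
Proof.
intros Hf Hg Hl X L X' F L' z; unfold z.
rewrite du_meridian, dv_meridian by assumption.
rewrite !mink_plus_l, !mink_scal_l, !mink_plus_r, !mink_scal_r.
assert (E : forall w, mink e1 w = x1 w) by (intros w; R4_unfold; ring).
rewrite (mink_sym (l v) e1), !E, L, X, X', F, L'.
replace (x1 e1) with 1 by reflexivity.
repeat split; ring.
Qed.

(** * Vanishing of the normal curvature *)

(** Normal vectors are orthogonal to [z_v = f l'], hence to [l'] and to the mixed
    derivatives [f' l']; with [meridian_metric] this gives an orthogonal conjugate
    net. *)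
Lemma meridian_normal_curvature_zero (I J : R -> Prop) (f g : R -> R)
    (l : R -> R4) (u v k : R) :
  interval I -> interval J -> smooth_on I f -> smooth_on I g ->
  0 < f u -> Derive f u ^ 2 + Derive g u ^ 2 <> 0 ->
  smooth_curve_on J l -> (forall t, J t -> deSitter2 (l t)) ->
  mink (vderive l v) (vderive l v) = -1 -> I u -> J v ->
  is_normal_curvature I J (meridian f g l) u v k -> k = 0.
Proof.
intros HI HJ (A1 & OA1 & IA1 & Hf) (A2 & OA2 & IA2 & Hg) fpos reg Hl HS Ht Iu Jv
  (U & X & Y & N1 & N2 & HU & Huv & HXu & HXv & HYu & HYv & HN1 & HN2 & HN & ->).
destruct (smooth_curve_neighbourhood J l Hl) as (B & OB & JB & SB).
destruct (smooth_curve_vderive B l v SB (JB v Jv)) as [Hl1 _].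
destruct (deSitter_curve_frame J l v HJ HS Jv Hl1) as (X0 & L & X0' & F).
destruct (meridian_metric f g l u v (Hf u (IA1 u Iu) 1%nat) (Hg u (IA2 u Iu) 1%nat)
  Hl1 X0 L X0' F Ht) as (E & F' & G).
destruct (meridian_second_partials f g l (fun s => A1 s /\ A2 s) B u v
  (open_and _ _ OA1 OA2) OB (fun s As => Hf s (proj1 As)) (fun s As => Hg s (proj2 As))
  SB (conj (IA1 u Iu) (IA2 u Iu)) (JB v Jv)) as (Pu & Pv & Euv & Evu).
set (z := meridian f g l) in *.
assert (C : forall n, is_normal z u v n -> mink n (vderive l v) = 0).
{ intros n [_ Hn]; unfold z in Hn; rewrite dv_meridian, mink_scal_r in Hn by exact Hl1.
  apply Rmult_integral in Hn; destruct Hn; [lra | assumption]. }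
destruct (HN u v Huv Iu Jv) as [_ (n1 & n2 & _)].
destruct (normal_field_partials I J U z N1 u v HI HJ Iu Jv HU Huv
  (smooth2_has_partials U N1 u v HN1 Huv) Pu Pv
  (fun s t Hst Is Jt => proj1 (proj2 (HN s t Hst Is Jt)))) as [K1 K2].
rewrite Euv, mink_scal_r, (C _ n1) in K1.
rewrite Evu, mink_scal_r, (C _ n1) in K2.
assert (f u ^ 2 <> 0) by (apply pow_nonzero; lra).
unfold normal_curvature; rewrite (RD_orthogonal_conjugate_net z X Y N1 u v);
  try assumption.
- unfold Rdiv; ring.
- apply (has_partials_flat_conn U); assumption.
- apply (has_partials_flat_conn U); assumption.
- apply (flat_conn_commutator U); assumption.
- unfold gram; rewrite E, F', G; intros D.
  apply (Rmult_integral_contrapositive_currified _ _ reg H); lra.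
- rewrite Euv, mink_scal_l, mink_sym, (C _ n2); ring.
- rewrite Evu, mink_scal_l, mink_sym, (C _ n2); ring.
- rewrite K1; ring.
- rewrite K2; ring.
Qed.

(** * Orthonormal frames on a meridian surface *)

(** The Lorentzian cross product of [span {e2, e3, e4}]: the Euclidean one with
    the sign of the timelike component reversed. *)
Definition cross (a b : R4) : R4 :=
  (0, x3 a * x4 b - x4 a * x3 b, x4 a * x2 b - x2 a * x4 b,
   x3 a * x2 b - x2 a * x3 b).

Lemma mink_cross_l a b : mink (cross a b) a = 0.
Proof. unfold cross; R4_unfold; ring. Qed.

Lemma mink_cross_r a b : mink (cross a b) b = 0.
Proof. unfold cross; R4_unfold; ring. Qed.

(** The Lagrange identity; in signature [(+, +, -)] its right-hand side is the
    opposite of the Gram determinant, so that the cross product of a unit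
    spacelike and a unit timelike vector orthogonal to each other is a unit
    spacelike vector. *)
Lemma mink_cross_cross a b :
  x1 a = 0 -> x1 b = 0 ->
  mink (cross a b) (cross a b) = mink a b ^ 2 - mink a a * mink b b.
Proof. intros A B; unfold mink; rewrite A, B; unfold cross; R4_unfold; ring. Qed.

Lemma inv_sqrt_sqr h : 0 < h -> / sqrt h * (/ sqrt h * h) = 1.
Proof.
intros H; assert (S := sqrt_lt_R0 h H).
rewrite <- (sqrt_sqrt h) at 3 by lra; field; lra.
Qed.

Definition meridian_speed (f g : R -> R) (s : R) : R :=
  Derive f s * Derive f s + Derive g s * Derive g s.

Definition frame_X (f g : R -> R) : tfield :=
  TField (fun s _ => / sqrt (meridian_speed f g s)) (fun _ _ => 0).

(** [/ sqrt (f * f)] is [/ f] for positive [f]; in this form its smoothness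
    is an instance of the same lemma as that of the other frame vectors. *)
Definition frame_Y (f : R -> R) : tfield :=
  TField (fun _ _ => 0) (fun s _ => / sqrt (f s * f s)).

Definition frame_N1 (l : R -> R4) (s t : R) : R4 := cross (l t) (vderive l t).

(** On a curve in [span {e2, e3, e4}] this is the unit normal
    [(f' e1 - g' l) / sqrt (f'^2 + g'^2)] of the profile curve.  Its first
    component leaves out the vanishing first component of [l], so that every
    component is a function of [s] times a function of [t]. *)
Definition frame_N2 (f g : R -> R) (l : R -> R4) (s t : R) : R4 :=
  let r := / sqrt (meridian_speed f g s) in
  (r * Derive f s, - (r * Derive g s) * x2 (l t),
   - (r * Derive g s) * x3 (l t), - (r * Derive g s) * x4 (l t)).

Lemma meridian_frames_orthonormal f g l s t :
  ex_derive f s -> ex_derive g s -> 0 < f s * f s ->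
  0 < meridian_speed f g s -> is_vderive l t (vderive l t) ->
  x1 (l t) = 0 -> mink (l t) (l t) = 1 -> x1 (vderive l t) = 0 ->
  mink (l t) (vderive l t) = 0 -> mink (vderive l t) (vderive l t) = -1 ->
  orthonormal_tangent (meridian f g l) (frame_X f g) (frame_Y f) s t /\
  orthonormal_normal (meridian f g l) (frame_N1 l) (frame_N2 f g l) s t.
Proof.
intros Df Dg fpos Epos Hl X0 L X0' F L'.
destruct (meridian_metric f g l s t Df Dg Hl X0 L X0' F L') as (ME & MF & MG).
assert (QE := inv_sqrt_sqr _ fpos); assert (RE := inv_sqrt_sqr _ Epos).
split.
- unfold orthonormal_tangent, push; simpl.
  rewrite !mink_plus_l, !mink_scal_l, !mink_plus_r, !mink_scal_r.
  rewrite !(mink_sym (dv _ _ _) (du _ _ _)), ME, MF, MG.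
  split; [|split; [|ring]].
  + transitivity (Rabs 1); [|exact Rabs_R1].
    f_equal; rewrite <- RE; unfold meridian_speed; ring.
  + transitivity (Rabs (Ropp 1)); [|rewrite Rabs_Ropp; exact Rabs_R1].
    f_equal; rewrite <- QE; ring.
- set (r := / sqrt (meridian_speed f g s)) in *.
  assert (EN : frame_N2 f g l s t = plus (scal (r * Derive f s) e1)
                                         (scal (- (r * Derive g s)) (l t))).
  { unfold frame_N2; fold r; apply R4_ext; R4_unfold; [|ring|ring|ring].
    change (fst (fst (fst (l t)))) with (x1 (l t)); rewrite X0; ring. }
  assert (E1 : forall w, mink e1 w = x1 w) by (intros w; R4_unfold; ring).
  unfold orthonormal_normal, is_normal; rewrite EN; unfold frame_N1.
  rewrite du_meridian, dv_meridian by assumption.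
  rewrite !mink_plus_r, !mink_scal_r, !mink_plus_l, !mink_scal_l.
  rewrite (mink_sym _ e1), (mink_sym (l t) e1), !E1.
  rewrite mink_cross_l, mink_cross_r, mink_cross_cross by assumption.
  rewrite X0, X0', L, F, L'.
  replace (x1 e1) with 1 by reflexivity.
  replace (x1 (cross (l t) (vderive l t))) with 0 by reflexivity.
  repeat split; try ring.
  transitivity (r * (r * meridian_speed f g s)); [|exact RE].
  unfold meridian_speed; ring.
Qed.

(** Every component of the frames is a product of a function of [s] and a
    function of [t]. *)
Lemma frames_smooth f g l A B :
  open A -> open B -> smooth A f -> smooth A g -> smooth_curve B l ->
  (forall s, A s -> 0 < f s * f s) ->
  (forall s, A s -> 0 < meridian_speed f g s) ->
  let U := fun p : R * R => A (fst p) /\ B (snd p) in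
  smooth2_on U (cu (frame_X f g)) /\ smooth2_on U (cv (frame_X f g)) /\
  smooth2_on U (cu (frame_Y f)) /\ smooth2_on U (cv (frame_Y f)) /\
  smooth2_vec_on U (frame_N1 l) /\ smooth2_vec_on U (frame_N2 f g l).
Proof.
intros OA OB sf sg (_ & s2 & s3 & s4) fpos Epos U.
assert (sq : smooth A (fun s => / sqrt (f s * f s))).
{ apply smooth_inv_sqrt; auto; apply smooth_mult; assumption. }
assert (sr : smooth A (fun s => / sqrt (meridian_speed f g s))).
{ apply smooth_inv_sqrt; auto; apply smooth_plus; auto;
    apply smooth_mult; auto; apply smooth_Derive; assumption. }
assert (sf' := smooth_mult A _ _ OA sr (smooth_Derive A f sf)).
assert (sg' := smooth_opp A _ (smooth_mult A _ _ OA sr (smooth_Derive A g sg))).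
assert (s2' := smooth_Derive _ _ s2).
assert (s3' := smooth_Derive _ _ s3).
assert (s4' := smooth_Derive _ _ s4).
assert (minor : forall a b c d,
  smooth B a -> smooth B b -> smooth B c -> smooth B d ->
  smooth B (fun t => a t * b t - c t * d t)).
{ intros a b c d Ha Hb Hc Hd; apply smooth_plus; [exact OB | |].
  - apply smooth_mult; assumption.
  - apply smooth_opp, smooth_mult; assumption. }
assert (inA : forall a, smooth A a -> smooth2_on U (fun s _ => a s)).
{ intros a Ha; apply (smooth2_prod A B a (fun _ => 1));
    [intros s t; apply Rmult_1_r | exact Ha | apply smooth_const]. }
assert (inB : forall b, smooth B b -> smooth2_on U (fun _ t => b t)).
{ intros b Hb; apply (smooth2_prod A B (fun _ => 1) b);
    [intros s t; apply Rmult_1_l | apply smooth_const | exact Hb]. }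
assert (zero2 : smooth2_on U (fun _ _ => 0)) by exact (inA _ (smooth_const A 0)).
split; [exact (inA _ sr)|].
split; [exact zero2|].
split; [exact zero2|].
split; [exact (inA _ sq)|].
split; (split; [|split; [|split]]).
- exact zero2.
- exact (inB _ (minor _ _ _ _ s3 s4' s4 s3')).
- exact (inB _ (minor _ _ _ _ s4 s2' s2 s4')).
- exact (inB _ (minor _ _ _ _ s3 s2' s2 s3')).
- exact (inA _ sf').
- exact (smooth2_prod A B _ _ _ (fun s t => eq_refl) sg' s2).
- exact (smooth2_prod A B _ _ _ (fun s t => eq_refl) sg' s3).
- exact (smooth2_prod A B _ _ _ (fun s t => eq_refl) sg' s4).
Qed.

(** The frames are defined on a product of neighbourhoods of [I] and [J], shrunk
    so that [f] and the squared speed of the profile curve stay positive. *)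
Lemma meridian_normal_curvature_exists (I J : R -> Prop) (f g : R -> R)
    (l : R -> R4) (u v : R) :
  interval J -> smooth_on I f -> smooth_on I g ->
  (forall s, I s -> 0 < f s) ->
  (forall s, I s -> Derive f s ^ 2 + Derive g s ^ 2 <> 0) ->
  smooth_curve_on J l -> (forall t, J t -> deSitter2 (l t)) ->
  (forall t, J t -> mink (vderive l t) (vderive l t) = -1) -> I u -> J v ->
  exists k, is_normal_curvature I J (meridian f g l) u v k.
Proof.
intros HJ (A1 & OA1 & IA1 & Hf) (A2 & OA2 & IA2 & Hg) fpos reg Hl HS Ht Iu Jv.
destruct (smooth_curve_neighbourhood J l Hl) as (B & OB & JB & SB).
set (A0 := fun s => A1 s /\ A2 s).
assert (OA0 : open A0) by (apply open_and; assumption).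
set (E := meridian_speed f g).
assert (sf0 : smooth A0 f) by (intros s [As _]; exact (Hf s As)).
assert (sg0 : smooth A0 g) by (intros s [_ As]; exact (Hg s As)).
assert (sE0 : smooth A0 E).
{ apply smooth_plus; [assumption | |]; apply smooth_mult; try assumption;
    apply smooth_Derive; assumption. }
assert (E0 : forall s, 0 <= E s).
{ intros s; unfold E, meridian_speed; assert (P := Rle_0_sqr (Derive f s));
    assert (Q := Rle_0_sqr (Derive g s)); unfold Rsqr in *; lra. }
(* As E >= 0, positivity of the product f E captures f > 0 and E > 0 at once. *)
set (A := fun s => A0 s /\ 0 < f s * E s).
assert (OA : open A).
{ apply open_positive; [exact OA0|]; apply smooth_mult; assumption. }
assert (Epos : forall s, A s -> 0 < E s).
{ intros s [_ P]; destruct (E0 s) as [Q|Q]; [exact Q|].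
  rewrite <- Q in P; lra. }
assert (ffpos : forall s, A s -> 0 < f s * f s).
{ intros s [_ P]; apply Rsqr_pos_lt; intros F0; rewrite F0 in P; lra. }
assert (IA : forall s, I s -> A s).
{ intros s Is; split; [split; auto|].
  apply Rmult_lt_0_compat; [apply fpos, Is|].
  destruct (E0 s) as [Q|Q]; [exact Q|exfalso].
  apply (reg s Is); rewrite Q; unfold E, meridian_speed; ring. }
destruct (frames_smooth f g l A B OA OB (fun s As => sf0 s (proj1 As))
  (fun s As => sg0 s (proj1 As)) SB ffpos Epos)
  as (SXu & SXv & SYu & SYv & SN1 & SN2).
eexists; exists (fun p => A (fst p) /\ B (snd p)), (frame_X f g), (frame_Y f),
  (frame_N1 l), (frame_N2 f g l).
split; [apply open_prod; assumption|].
split; [split; simpl; auto|].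
do 6 (split; [assumption|]).
split; [|reflexivity].
intros s t [As Bt] Is Jt; simpl in As, Bt.
destruct (smooth_curve_vderive B l t SB Bt) as [Hl1 _].
destruct (deSitter_curve_frame J l t HJ HS Jt Hl1) as (X0 & L & X0' & F).
apply meridian_frames_orthonormal; auto.
- exact (Hf s (IA1 s Is) 1%nat).
- exact (Hg s (IA2 s Is) 1%nat).
Qed.

Theorem proposition4p1 (I J : R -> Prop) (f g : R -> R) (l : R -> R4)
  (hI : interval I) (hJ : interval J)
  (hf : smooth_on I f) (hg : smooth_on I g)
  (hfpos : forall u, I u -> 0 < f u)
  (hreg : forall u, I u -> Derive f u ^ 2 + Derive g u ^ 2 <> 0)
  (hl : smooth_curve_on J l)
  (hlS : forall v, J v -> deSitter2 (l v))
  (hlt : forall v, J v -> mink (vderive l v) (vderive l v) = -1) :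
  flat_normal_connection I J (meridian f g l).
Proof.
intros u v Iu Jv.
assert (Z : forall k, is_normal_curvature I J (meridian f g l) u v k -> k = 0).
{ intros k; apply meridian_normal_curvature_zero; auto. }
intros k; split; [apply Z|intros ->].
destruct (meridian_normal_curvature_exists I J f g l u v) as [k Hk]; auto.
rewrite <- (Z k Hk); exact Hk.
Qed.
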